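(* Let $a,b\ge 2$ be integers. Then the Ehrhart polynomial of the matroid basis polytope $P_{S(a,b)}$ is $$L_{P_{S(a,b)}}(t)=1+\frac{1}{(a-1)!\,(b-1)!} \sum_{i=1}^{a+b-1} \left(\sum_{j=i-1}^{a+b-2} (-1)^{j-i+1}\, \frac{B_{j-i+1}\,\sigma_{a+b-2-j}}{j+1} \binom{j+1}{i}\right) t^i,$$ where $\sigma_\ell$ is the $\ell$-th elementary symmetric function evaluated on the $a+b-2$ numbers $1,2,\ldots,a-1,1,2,\ldots,b-1$ (with $\sigma_0=1$), and $B_s$ is the $s$-th Bernoulli number.
   Context: For lattice paths $U,L$ from $(0,0)$ to $(m,r)$ using unit steps $(1,0),(0,1)$ with $L$ never above $U$, the lattice path matroid $M[U,L]$ is the matroid on $\{1,\dots,r+m\}$ whose bases are the sets of indices of the $(0,1)$-steps of lattice paths from $(0,0)$ to $(m,r)$ never above $U$ and never below $L$. The snake $S(a,b)$ is the lattice path matroid whose region between $U$ and $L$ is the strip of unit squares consisting of a horizontal row of $a$ unit squares starting with $[0,1]\times[0,1]$, followed by a vertical column of $b$ unit squares whose bottom square is the last square of that row (so $a+b-1$ squares in total). The matroid basis polytope is $P_M=\mathrm{conv}\{\sum_{i\in B}e_i: B\text{ a basis}\}$, and for a lattice polytope $P\subseteq\mathbb{R}^n$, $L_P(t)=\#(tP\cap\mathbb{Z}^n)$ for integers $t\ge0$ is its Ehrhart polynomial. Bernoulli numbers use the standard convention $B_0=1$, $B_1=-\tfrac12$, $B_2=\tfrac16,\dots$. *)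

(* Defs.v *)
From mathcomp Require Import all_boot all_order all_algebra.
From mathcomp Require Import mathcomp_extra boolp classical_sets functions.
From mathcomp Require Import cardinality reals.
From mathcomp Require Import zify lra.

Set Implicit Arguments.
Unset Strict Implicit.
Unset Printing Implicit Defensive.

Import Order.TTheory GRing.Theory Num.Theory.

Record matroid (T : finType) := Matroid {
  bases : {set {set T}};
  bases_neq0 : bases != finset.set0;
  bases_exchange : forall B B' : {set T}, B \in bases -> B' \in bases ->
    forall x, x \in B :\: B' ->
    exists2 y, y \in B' :\: B & y |: (B :\ x) \in bases }.

(* A lattice path starting at (0,0) is the word of its steps: [true] is the
   step (0,1) and [false] is the step (1,0). *)
Definition lattice_path (m r : nat) (P : seq bool) : bool :=
  (count negb P == m) && (count id P == r).

(* The ordinate reached after k steps; the abscissa is then k minus it. *)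
Definition height (P : seq bool) (k : nat) : nat := count id (take k P).

(* After k steps every path lies on the antidiagonal x + y = k, so that the
   relative position of two paths is read off on each antidiagonal. *)
Definition never_above (P Q : seq bool) : bool :=
  [forall k : 'I_(size P).+1, height P k <= height Q k].

(* The elements 1, ..., m + r of the ground set are represented by the
   ordinals 0, ..., m + r - 1. *)
Definition lpm_bases (m r : nat) (U L : seq bool) : {set {set 'I_(m + r)}} :=
  [set [set i : 'I_(m + r) | tnth P i]
     | P : (m + r).-tuple bool
     & [&& lattice_path m r P, never_above P U & never_above L P]]%SET.

Lemma lattice_path_size m r P : lattice_path m r P -> size P = m + r.
Proof.
by case/andP=> /eqP <- /eqP <-; rewrite -(count_predC id P) addnC.
Qed.

Lemma heightS P k : height P k.+1 = height P k + nth false P k.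
Proof.
rewrite /height; case: (ltnP k (size P)) => hk.
  by rewrite (take_nth false hk) -cats1 count_cat /= addn0.
by rewrite !take_oversize ?nth_default ?addn0 // ltnW.
Qed.

Lemma height0 P : height P 0 = 0.
Proof. by rewrite /height take0. Qed.

Lemma height_size P k : size P <= k -> height P k = count id P.
Proof. by move=> h; rewrite /height take_oversize. Qed.

Lemma never_aboveP n P Q : size P = n -> size Q = n ->
  reflect (forall k, height P k <= height Q k) (never_above P Q).
Proof.
move=> sP sQ; apply: (iffP forallP) => [h k|h k]; last exact: h.
case: (leqP k n) => hk.
  have hk' : k < (size P).+1 by rewrite sP.
  exact: (h (Ordinal hk')).
have hn : n < (size P).+1 by rewrite sP.
have := h (Ordinal hn); rewrite /= !height_size ?sP ?sQ //; exact: ltnW.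
Qed.

Lemma mem_lpm_bases m r U L (B : {set 'I_(m + r)}) :
  reflect (exists P : (m + r).-tuple bool,
     [/\ B = [set i | tnth P i]%SET, lattice_path m r P,
         never_above P U & never_above L P])
    (B \in lpm_bases m r U L).
Proof.
apply: (iffP imsetP) => [[P + ->]|[P [-> h1 h2 h3]]].
  by rewrite inE => /and3P[h1 h2 h3]; exists P; split.
by exists P => //; rewrite inE h1 h2 h3.
Qed.

Lemma exchange_left P Q p : height P p < height Q p ->
  exists q, [/\ q < p, ~~ nth false P q, nth false Q q &
    forall k, q < k <= p -> height P k < height Q k].
Proof.
elim: p => [|p IH]; first by rewrite !height0.
move=> hp; case: (ltnP (height P p) (height Q p)) => [/IH[q [h1 h2 h3 h4]]|h].
  exists q; split=> // [|k /andP[k1]]; first exact: ltnW.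
  by rewrite leq_eqVlt => /predU1P[->//|k2]; apply: h4; lia.
exists p; move: (hp); rewrite !heightS.
case hP: (nth false P p); case hQ: (nth false Q p); try by lia.
by move=> _; split=> // k hk; have -> : k = p.+1 by lia.
Qed.

Lemma exchange_right P Q d p :
  height Q p < height P p -> height P (p + d) <= height Q (p + d) ->
  exists q, [/\ p <= q, ~~ nth false P q, nth false Q q &
    forall k, p <= k <= q -> height Q k < height P k].
Proof.
elim: d p => [|d IH] p hp; first by rewrite addn0; lia.
rewrite addnS -addSn => hd.
case: (ltnP (height Q p.+1) (height P p.+1)) => [h|].
  have [q [h1 h2 h3 h4]] := IH _ h hd.
  exists q; split=> // [|k /andP[]]; first exact: ltnW.
  by rewrite leq_eqVlt => /predU1P[<-//|k2 k3]; apply: h4; lia.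
rewrite !heightS.
case hP: (nth false P p); case hQ: (nth false Q p); try by lia.
by move=> _; exists p; split; rewrite ?hP ?hQ // => k hk; have -> : k = p by lia.
Qed.

Lemma lpm_exchange m r U L : lattice_path m r U -> lattice_path m r L ->
  forall B B' : {set 'I_(m + r)},
    B \in lpm_bases m r U L -> B' \in lpm_bases m r U L ->
    forall x, x \in B :\: B' ->
    exists2 y, y \in B' :\: B & y |: (B :\ x) \in lpm_bases m r U L.
Proof.
move=> /lattice_path_size sU /lattice_path_size sL B B'.
case/mem_lpm_bases=> P [-> pP hPU hLP] /mem_lpm_bases[Q [-> pQ hQU hLQ]] p.
have sP := size_tuple P; have sQ := size_tuple Q.
rewrite !inE !(tnth_nth false) => /andP[nQp nPp].
move/(never_aboveP sP sU): hPU => hPU; move/(never_aboveP sL sP): hLP => hLP.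
move/(never_aboveP sQ sU): hQU => hQU; move/(never_aboveP sL sQ): hLQ => hLQ.
have cP : height P (m + r) = r.
  by rewrite height_size ?sP //; case/andP: pP => _ /eqP.
have cQ : height Q (m + r) = r.
  by rewrite height_size ?sQ //; case/andP: pQ => _ /eqP.
have [q [nPq nQq qlt hq]] : exists q, [/\ ~~ nth false P q, nth false Q q,
    q < m + r & forall k, height L k + (p < k) <= height P k + (q < k)
                    /\ height P k + (q < k) <= height U k + (p < k)].
  case: (ltnP (height P p) (height Q p)) => hp.
    have [q [h1 h2 h3 h4]] := exchange_left hp.
    exists q; split=> // [|k]; first by apply: ltn_trans h1 _.
    have := hPU k; have := hLP k; have := hQU k; have := h4 k.
    by case: (ltnP q k); case: (ltnP p k); lia.
  have hp1 : height Q p.+1 < height P p.+1.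
    by rewrite !heightS nPp (negbTE nQp); lia.
  have hd : height P (p.+1 + (m + r - p.+1)) <= height Q (p.+1 + (m + r - p.+1)).
    by rewrite subnKC ?cP ?cQ.
  have [q [h1 h2 h3 h4]] := exchange_right hp1 hd.
  exists q; split=> // [|k].
    by rewrite ltnNge; apply/negP => hq; rewrite nth_default ?sQ in h3.
  have := hPU k; have := hLP k; have := hLQ k; have := h4 k.
  by case: (ltnP q k); case: (ltnP p k); lia.
pose y : 'I_(m + r) := Ordinal qlt.
exists y; first by rewrite !inE !(tnth_nth false) nPq nQq.
pose P' := [tuple (i == y) || ((i != p) && tnth P i) | i < m + r].
have sP' := size_tuple P'.
have nP' (i : 'I_(m + r)) : nth false P' i = (i == y) || ((i != p) && tnth P i).
  by rewrite -tnth_nth tnth_mktuple.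
clearbody P'.
have pq : (p == y) = false.
  by apply/eqP => e; move: nPq; rewrite -[q]/(val y) -e nPp.
have hP' k : height P' k + (p < k) = height P k + (q < k).
  elim: k => [|k IH]; first by rewrite !height0 !ltn0.
  rewrite !heightS; case: (ltnP k (m + r)) => hk; last first.
    rewrite (nth_default _ (_ : size P' <= k)) ?sP' //.
    rewrite (nth_default _ (_ : size P <= k)) ?sP //.
    by have := ltn_ord p; lia.
  have := nP' (Ordinal hk); rewrite (tnth_nth false) /= => ->.
  rewrite -!(inj_eq val_inj) /= -!/(nat_of_ord p).
  have hpq : (p == q :> nat) = false by have := pq; rewrite -(inj_eq val_inj).
  have := hpq.
  case: (eqVneq k q) => [ekq|nkq].
    by move: nPq; rewrite -ekq => /negbTE -> /=; lia.
  case: (eqVneq k (p : nat)) => [ekp|nkp] /=; last by lia.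
  by move: IH; rewrite ekp nPp; lia.
have cP' : count id P' = r.
  have := hP' (m + r); rewrite height_size ?sP' // cP.
  by have := ltn_ord p; lia.
apply/mem_lpm_bases; exists P'; split.
- apply/setP => i; by rewrite !inE (tnth_nth false P') nP'.
- apply/andP; split; last by rewrite cP'.
  by have := count_predC id P'; rewrite cP' sP' => /eqP; rewrite addnC eqn_add2r.
- apply/(never_aboveP sP' sU) => k; have := hP' k; have [_] := hq k; lia.
- apply/(never_aboveP sL sP') => k; have := hP' k; have [+ _] := hq k; lia.
Qed.

Lemma lpm_neq0 m r U L : lattice_path m r U -> lattice_path m r L ->
  never_above L U -> lpm_bases m r U L != finset.set0.
Proof.
move=> pU pL hLU; apply/set0Pn.
have sU : size U == m + r by rewrite (lattice_path_size pU).
exists [set i : 'I_(m + r) | tnth (Tuple sU) i]%SET.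
apply/mem_lpm_bases; exists (Tuple sU); split=> //.
by apply/forallP => k.
Qed.

Definition lattice_path_matroid (m r : nat) (U L : seq bool)
    (pU : lattice_path m r U) (pL : lattice_path m r L)
    (LU : never_above L U) : matroid 'I_(m + r) :=
  Matroid (lpm_neq0 pU pL LU) (lpm_exchange pU pL).

Definition snake_upper (a b : nat) : seq bool :=
  true :: nseq a.-1 false ++ nseq b.-1 true ++ [:: false].

Definition snake_lower (a b : nat) : seq bool := nseq a false ++ nseq b true.

Lemma snake_upper_path a b : 0 < a -> 0 < b -> lattice_path a b (snake_upper a b).
Proof.
by move=> a0 b0; rewrite /lattice_path /= !count_cat !count_nseq /=; lia.
Qed.

Lemma snake_lower_path a b : lattice_path a b (snake_lower a b).
Proof. by rewrite /lattice_path /= !count_cat !count_nseq /=; lia. Qed.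

Lemma count_take_nseq k n c : count id (take k (nseq n c)) = minn k n * c.
Proof.
elim: n k => [|n IH] [|k] //=; rewrite ?minn0 ?min0n //.
by rewrite IH minnSS mulSn.
Qed.

Lemma height_cat P Q k : height (P ++ Q) k = height P k + height Q (k - size P).
Proof.
rewrite /height take_cat; case: ltnP => h; last by rewrite count_cat (take_oversize h).
by rewrite (eqP (ltnW h : k - size P == 0)) take0 addn0.
Qed.

Lemma height_snake_upper a b k : 0 < a -> 0 < b ->
  height (snake_upper a b) k = (0 < k) + minn (k - a) b.-1.
Proof.
move=> a0 b0; case: k => [|k]; first by rewrite height0 /=; lia.
rewrite /snake_upper -cat1s !height_cat /height !count_take_nseq !size_nseq /=.
case: (k.+1 - _ - _ - _) => [|j] /=; lia.
Qed.

Lemma height_snake_lower a b k : height (snake_lower a b) k = minn (k - a) b.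
Proof. by rewrite height_cat /height !count_take_nseq size_nseq; lia. Qed.

Lemma snake_lower_upper a b : 0 < a -> 0 < b ->
  never_above (snake_lower a b) (snake_upper a b).
Proof.
move=> a0 b0; apply/forallP => k.
by rewrite height_snake_upper // height_snake_lower; lia.
Qed.

(* The unit square [x, x+1] * [y, y+1] lies between L and U iff its corner
   (x, y+1) is not above U and its corner (x+1, y) is not below L. *)
Definition square_between (U L : seq bool) (x y : nat) : bool :=
  (y < height U (x + y).+1) && (height L (x + y).+1 <= y).

Lemma snake_squares a b x y : 0 < a -> 0 < b ->
  square_between (snake_upper a b) (snake_lower a b) x y =
  ((y == 0) && (x < a)) || ((x == a.-1) && (y < b)).
Proof.
by move=> a0 b0; rewrite /square_between height_snake_upper // height_snake_lower; lia.
Qed.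

(* S(a, b); the region between its two paths is described by [snake_squares]. *)
Definition snake (a b : nat) (a0 : 0 < a) (b0 : 0 < b) : matroid 'I_(a + b) :=
  lattice_path_matroid (snake_upper_path a0 b0) (snake_lower_path a b)
    (snake_lower_upper a0 b0).

Local Open Scope classical_set_scope.
Local Open Scope card_scope.
Local Open Scope ring_scope.

Definition convex_hull (R : realType) (n : nat) (I : finType) (D : {set I})
    (v : I -> 'rV[R]_n) : set 'rV[R]_n :=
  [set x | exists2 w : I -> R,
     (forall i, i \in D -> 0 <= w i) /\ \sum_(i in D) w i = 1
     & x = \sum_(i in D) w i *: v i].

Definition basis_polytope (R : realType) (n : nat) (M : matroid 'I_n) :
    set 'rV[R]_n :=
  convex_hull (bases M) (fun B => \sum_(i in B) delta_mx ord0 i).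

Definition integer_points (R : realType) (n : nat) : set 'rV[R]_n :=
  [set x | forall i, x ord0 i \is a Num.int].

Arguments basis_polytope R {n} M.
Arguments integer_points R n : clear implicits.

(* p.[t] = #(tP \cap Z^n) for all integers t >= 0; such a p is unique. *)
Definition is_ehrhart_polynomial (R : realType) (n : nat) (P : set 'rV[R]_n)
    (p : {poly rat}) : Prop :=
  forall t : nat, exists2 k : nat,
    ([set t%:R *: x | x in P] `&` integer_points R n) #= `I_k
    & p.[t%:R] = k%:R.

(* [:: B_0; ...; B_(n-1)], from
   \sum_(k <= n) 'C(n.+1, k) B_k = (n == 0) solved for B_n. *)
Fixpoint bernoulli_seq (n : nat) : seq rat :=
  if n is n'.+1 then
    let s := bernoulli_seq n' in
    rcons s (((n' == 0%N)%:R - \sum_(k < n') 'C(n'.+1, k)%:R * s`_k)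
               / n'.+1%:R)
  else [::].

Definition bernoulli (n : nat) : rat := (bernoulli_seq n.+1)`_n.

Lemma size_bernoulli_seq n : size (bernoulli_seq n) = n.
Proof. by elim: n => //= n IH; rewrite size_rcons IH. Qed.

Lemma nth_bernoulli_seq n k : (k < n)%N -> (bernoulli_seq n)`_k = bernoulli k.
Proof.
elim: n => //= n IH; rewrite ltnS leq_eqVlt => /predU1P[-> //|kn].
by rewrite nth_rcons size_bernoulli_seq kn IH.
Qed.

Lemma bernoulli_rec n :
  \sum_(k < n.+1) 'C(n.+1, k)%:R * bernoulli k = (n == 0%N)%:R.
Proof.
rewrite big_ord_recr /= binSn {2}/bernoulli /=.
rewrite nth_rcons size_bernoulli_seq ltnn eqxx.
rewrite mulrCA divff ?pnatr_eq0 // mulr1.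
under eq_bigr => k _ do rewrite -(nth_bernoulli_seq (ltn_ord k)).
by rewrite addrC subrK.
Qed.

Lemma bernoulli0 : bernoulli 0 = 1.
Proof. by rewrite /bernoulli /= big_ord0 subr0 divr1. Qed.

Lemma bernoulli1 : bernoulli 1 = - (1 / 2%:R).
Proof.
have := bernoulli_rec 1; rewrite !big_ord_recr big_ord0 /= bernoulli0 bin0 bin1.
by lra.
Qed.

Definition elem_sym (s : seq rat) (l : nat) : rat :=
  \sum_(I : {set 'I_(size s)} | #|I| == l) \prod_(i in I) s`_i.

Definition snake_seq (a b : nat) : seq rat :=
  [seq i%:R | i <- iota 1 a.-1 ++ iota 1 b.-1].

(* Main.v *)
Require Import Defs.
From mathcomp Require Import all_boot all_order all_algebra.
From mathcomp Require Import classical_sets cardinality.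
From mathcomp Require Import zify ring.
From mathcomp Require Import reals.

(* A basis of S(a, b) is either the whole column, or the column with one element
   exchanged for an element of the row.  After the reflection y -> t - y of the
   column coordinates, the integer points of t P are therefore the pairs of a
   weak composition into a parts and one into b parts of the same s <= t, whence
     L(t) = \sum_(s <= t) 'C(s + a - 1, a - 1) 'C(s + b - 1, b - 1).
   Here (a - 1)! (b - 1)! times the summand is the product of the s + y over the
   a + b - 2 numbers y; it is 1 after normalization at s = 0, and for s >= 1 one
   expands it in powers of s and applies Faulhaber's formula. *)

Import Order.TTheory GRing.Theory Num.Theory.
Local Open Scope ring_scope.

(** * Bernoulli polynomials and Faulhaber's formula *)

(** Ordered pairs of disjoint subsets, chosen in either order: both sides are N! / (k! i! (N - k -
    i)!), or 0 when i + k > N. *)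
Lemma mul_bin_subC N i k :
  ('C(N, k) * 'C(N - k, i) = 'C(N, i) * 'C(N - i, k))%N.
Proof.
have [le_ikN | lt_N_ik] := leqP (i + k) N; last first.
  have bin0s n u v : (n < u + v)%N -> ('C(n, u) * 'C(n - u, v) = 0)%N.
    move=> lt_n; have [le_un | lt_nu] := leqP u n; last by rewrite bin_small.
    by rewrite (@bin_small (n - u)) ?muln0 //; lia.
  by rewrite !bin0s // addnC.
have eN u v : (u + v <= N)%N ->
    ('C(N, u) * 'C(N - u, v) * (u`! * v`! * (N - u - v)`!) = N`!)%N.
  move=> le_uvN; rewrite -(@bin_fact N u) -?(@bin_fact (N - u) v); [|lia..].
  by rewrite !mulnA; ring.
have /eqP := eN i k le_ikN; rewrite -(eN k i) ?(addnC k) // (mulnC i`!) subnAC.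
by rewrite eqn_pmul2r ?muln_gt0 ?fact_gt0 // => /eqP.
Qed.

(** The range of summation is made independent of [M], so that double sums can be exchanged; the
    added terms have binomial coefficient 0. *)
Lemma exprB1_widen {R : comNzRingType} (x : R) {M N : nat} : (M <= N)%N ->
  (x - 1) ^+ M = \sum_(i < N.+1) (-1) ^+ (M - i) * 'C(M, i)%:R * x ^+ i.
Proof.
move=> le_MN; rewrite addrC exprDn.
rewrite (big_ord_widen N.+1 (fun i => (-1) ^+ (M - i) * x ^+ i *+ 'C(M, i))) //.
rewrite [LHS]big_mkcond /=; apply: eq_bigr => i _.
case: ltnP => [_|lt_Mi]; first by rewrite -mulr_natr mulrAC.
by rewrite bin_small // mulr0 mul0r.
Qed.

(** This is the value B_n(1) of the Bernoulli polynomial, obtained from the recurrence by adding its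
    missing top term. *)
Lemma sum_bin_bernoulli n :
  \sum_(k < n.+1) 'C(n, k)%:R * bernoulli k = bernoulli n + (n == 1%N)%:R.
Proof.
case: n => [|n]; first by rewrite big_ord1 mul1r addr0.
by rewrite big_ord_recr /= bernoulli_rec binn mul1r addrC eqSS.
Qed.

(* (-1)^N B_N(-x), where B_N is the N-th Bernoulli polynomial. *)
Definition bernoulli_sum (N : nat) (x : rat) : rat :=
  \sum_(i < N.+1) (-1) ^+ (N - i) * bernoulli (N - i) * 'C(N, i)%:R * x ^+ i.

(** The difference equation B_N(y + 1) - B_N(y) = N y^(N-1) at y = -x. Once (x - 1)^(N-k) is
    expanded, the coefficient of x^i contains B_(N-i)(1), which differs from B_(N-i) only at i = N -
    1. *)
Lemma bernoulli_sumB1 N x :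
  bernoulli_sum N x - bernoulli_sum N (x - 1) = N%:R * x ^+ N.-1.
Proof.
suff -> : bernoulli_sum N (x - 1) = bernoulli_sum N x - N%:R * x ^+ N.-1.
  by rewrite opprB addrC subrK.
rewrite /bernoulli_sum (reindex_inj rev_ord_inj) /=.
(* [c k i] is the contribution of [bernoulli k] to the term in x^i of [bernoulli_sum N (x - 1)]. *)
pose c k i := (-1) ^+ (N - i) * 'C(N, i)%:R * x ^+ i * ('C(N - i, k)%:R * bernoulli k).
transitivity (\sum_(k < N.+1) \sum_(i < N.+1) c k i).
  apply: eq_bigr => k _; rewrite subSS subKn ?leq_ord // bin_sub ?leq_ord //.
  rewrite (exprB1_widen _ (leq_subr k N)) mulr_sumr.
  apply: eq_bigr => i _.
  rewrite /c; have := mul_bin_subC N i k.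
  have [le_ikN | lt_N_ik] := leqP (i + k) N => e; last first.
    rewrite (@bin_small (N - k) i) ?(@bin_small (N - i) k) ?mulr0 ?mul0r ?mulr0 //;
      by have := leq_ord i; have := leq_ord k; lia.
  have -> : (N - i = k + (N - k - i))%N by lia.
  rewrite exprD; transitivity ((-1) ^+ k * (-1) ^+ (N - k - i) * bernoulli k
     * x ^+ i * ('C(N, k) * 'C(N - k, i))%N%:R); first by rewrite natrM; ring.
  by rewrite e natrM; have -> : (N - i = k + (N - k - i))%N; [lia|ring].
rewrite exchange_big /=.
transitivity (\sum_(i < N.+1) (-1) ^+ (N - i) * 'C(N, i)%:R * x ^+ i *
    (bernoulli (N - i) + ((N - i)%N == 1%N)%:R)).
  apply: eq_bigr => i _; rewrite /c -mulr_sumr -sum_bin_bernoulli.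
  congr (_ * _).
  rewrite [RHS](big_ord_widen N.+1 (fun k => 'C(N - i, k)%:R * bernoulli k));
    last by lia.
  rewrite [RHS]big_mkcond /=; apply: eq_bigr => k _.
  by case: ltnP => // lt; rewrite bin_small // mul0r.
under [LHS]eq_bigr do rewrite mulrDr.
rewrite big_split /=; congr (_ + _); first by apply: eq_bigr => i _; ring.
case: N @c => [|N] _; first by rewrite big_ord1 /= mulr0 mul0r oppr0.
rewrite !big_ord_recr /= subnn mulr0 addr0 subSn // subnn eqxx mulr1 binSn.
rewrite big1 ?add0r ?expr1 ?mulN1r ?mulNr // => i _.
by rewrite (_ : _ == 1%N = false) ?mulr0 //; have := ltn_ord i; lia.
Qed.

(** The difference equation for N = j + 1 telescopes over s. The sign turns B_1 into +1/2, as fits a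
    sum that includes s = t. *)
Lemma faulhaber j t :
  \sum_(1 <= s < t.+1) (s%:R : rat) ^+ j =
  \sum_(1 <= i < j.+2) (-1) ^+ (j.+1 - i) * bernoulli (j.+1 - i) / j.+1%:R
     * 'C(j.+1, i)%:R * t%:R ^+ i.
Proof.
have tel : \sum_(1 <= s < t.+1) j.+1%:R * (s%:R : rat) ^+ j =
    bernoulli_sum j.+1 t%:R - bernoulli_sum j.+1 0.
  elim: t => [|t IH]; first by rewrite big_geq // subrr.
  rewrite big_nat_recr //= IH -[j.+1%:R * _]/(j.+1%:R * t.+1%:R ^+ j.+1.-1).
  by rewrite -bernoulli_sumB1 -[t.+1%:R]natr1 addrK; ring.
apply: (@mulfI _ (j.+1%:R : rat)); first by rewrite pnatr_eq0.
rewrite mulr_sumr tel /bernoulli_sum -!(big_mkord predT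
  (fun i => (-1) ^+ (j.+1 - i) * bernoulli (j.+1 - i) * 'C(j.+1, i)%:R * _ ^+ i)).
(* At 0 only the term i = 0 survives, and it cancels the one at t; hence the sum starts at i = 1. *)
rewrite ![in LHS](big_nat_recl j.+1) // !expr0.
rewrite [X in _ - (_ + X)]big1 => [|i _]; last by rewrite expr0n mulr0.
rewrite addr0 addrAC subrr add0r mulr_sumr [RHS]big_add1.
by apply: eq_bigr => i _; field; rewrite nat1r pnatr_eq0.
Qed.

(** * From the stated polynomial to a sum of products of binomials *)

(** Expand over the set J of factors that contribute y instead of x, and group the J by
    cardinality. *)
Lemma prod_add_elem_sym (s : seq rat) (x : rat) :
  \prod_(y <- s) (x + y) =
  \sum_(0 <= j < (size s).+1) elem_sym s (size s - j) * x ^+ j.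
Proof.
rewrite big_mkord (reindex_inj rev_ord_inj) /= (big_nth 0) big_mkord.
under [LHS]eq_bigr do rewrite addrC.
rewrite bigA_distr (partition_big (fun J : {set 'I_(size s)} =>
  inord #|J| : 'I_(size s).+1) predT) //=.
have cardK (J : {set 'I_(size s)}) : (inord #|J| : 'I_(size s).+1) = #|J| :> nat.
  by rewrite inordK // ltnS (leq_trans (max_card _)) ?card_ord.
apply: eq_bigr => l _; rewrite subSS subKn ?leq_ord // /elem_sym mulr_suml.
apply: eq_big => [J | J /eqP <-]; first by rewrite -(inj_eq val_inj) /= cardK.
rewrite cardK (bigID (mem J)) /=.
congr (_ * _); first by apply: eq_bigr => i ->.
have -> : (size s - #|J| = #|~: J|)%N by rewrite [RHS]cardsCs finset.setCK card_ord.
rewrite -prodr_const.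
by apply: eq_big => [i | i /negbTE ->]; rewrite ?inE.
Qed.

Lemma prod_rising_bin (s n : nat) :
  (\prod_(i <- iota 1 n) (s + i) = 'C(s + n, n) * n`!)%N.
Proof.
elim: n => [|n IH]; first by rewrite big_nil bin0.
rewrite -(addn1 n) iotaD big_cat big_seq1 /= IH add1n addn1 addnS factS.
by rewrite mulnCA mulnA -mul_bin_diag /=; ring.
Qed.

Lemma snake_sum_bin (a b t : nat) : (0 < a)%N -> (0 < b)%N ->
  (1 + ((a.-1)`!%:R * (b.-1)`!%:R)^-1 *:
       \sum_(1 <= i < a + b)
         (\sum_(i.-1 <= j < a + b - 1)
            (-1) ^+ (j.+1 - i)
            * (bernoulli (j.+1 - i) * elem_sym (snake_seq a b) (a + b - 2 - j)
               / j.+1%:R)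
            * 'C(j.+1, i)%:R) *: 'X^i : {poly rat}).[t%:R] =
  (\sum_(s < t.+1) 'C(s + a.-1, a.-1) * 'C(s + b.-1, b.-1))%N%:R.
Proof.
case: a b => [//|a] [//|b] _ _ /=.
have -> : (a.+1 + b.+1 = (a + b).+2)%N by lia.
rewrite subn1 subn2 /=; set N := (a + b)%N; set f : rat := _ * _.
have f0 : f != 0 by rewrite mulf_neq0 ?pnatr_eq0 -?lt0n ?fact_gt0.
rewrite hornerE hornerZ hornerC horner_sum; apply: (mulfI f0).
rewrite mulrDr mulrA divff // mul1r mulr1.
have prodE (s : nat) : f * ('C(s + a, a) * 'C(s + b, b))%N%:R =
    \sum_(0 <= j < N.+1) elem_sym (snake_seq a.+1 b.+1) (N - j) * s%:R ^+ j.
  have szN : size (snake_seq a.+1 b.+1) = N.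
    by rewrite size_map size_cat !size_iota.
  have binE m : \prod_(i <- iota 1 m) (s%:R + i%:R) = ('C(s + m, m) * m`!)%N%:R :> rat.
    by rewrite -prod_rising_bin natr_prod; apply: eq_bigr => i _; rewrite natrD.
  by rewrite -szN -prod_add_elem_sym big_map big_cat /= !binE /f !natrM; ring.
rewrite -(big_mkord xpredT (fun s => 'C(s + a, a) * 'C(s + b, b))%N).
(* The summand s = 0 gives the leading 1; the others start at s = 1, where Faulhaber's sum does. *)
rewrite natr_sum mulr_sumr [RHS]big_ltn // !add0n !binn mulr1; congr (_ + _).
under [RHS]eq_bigr do rewrite prodE.
rewrite exchange_big /=.
under [RHS]eq_bigr => j _ do rewrite -mulr_sumr faulhaber mulr_sumr.
under [LHS]eq_bigr => i _ do rewrite hornerZ hornerXn mulr_suml.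
(* Extending the coefficients by zero from the triangle i <= j + 1 to a rectangle lets the two sums
   be exchanged. *)
pose G i j : rat := if (i <= j.+1)%N then
  (-1) ^+ (j.+1 - i) * (bernoulli (j.+1 - i) * elem_sym (snake_seq a.+1 b.+1) (N - j)
               / j.+1%:R) * 'C(j.+1, i)%:R * t%:R ^+ i else 0.
transitivity (\sum_(1 <= i < N.+2) \sum_(0 <= j < N.+1) G i j).
  apply: eq_big_nat => i /andP[i_gt0 _].
  rewrite (big_nat_widenl _ 0%N) // big_mkcond; apply: eq_bigr => j _.
  by rewrite /G (_ : (i.-1 <= j)%N = (i <= j.+1)%N) //; lia.
rewrite exchange_big_nat; apply: eq_big_nat => j /andP[_ lt_jN] /=.
rewrite [RHS](big_nat_widen _ _ N.+2) // [RHS]big_mkcond.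
apply: eq_bigr => i _; rewrite /G ltnS; case: ifP => // _; ring.
Qed.

(** * The bases of the snake *)

Lemma height_sum (P : seq bool) (k : nat) :
  height P k = (\sum_(i < k) nth false P i)%N.
Proof.
by elim: k => [|k IH]; rewrite ?height0 ?big_ord0 // heightS IH big_ord_recr.
Qed.

Lemma height_addr (P : seq bool) (k d : nat) :
  (height P k <= height P (k + d) <= height P k + d)%N.
Proof.
elim: d => [|d IH]; first by rewrite !addn0 leqnn.
by rewrite addnS heightS; case: (nth _ _ _); lia.
Qed.

(** The upper path constrains only the height after a steps: each step raises the height by 0 or 1,
    which gives the other upper bounds. The lower bound holds because the remaining steps must still
    reach height b. *)
Lemma mem_snake_bases a b (a0 : (0 < a)%N) (b0 : (0 < b)%N)
    (B : {set 'I_(a + b)}) :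
  (B \in bases (snake a0 b0)) =
  (\sum_(i < a) (lshift b i \in B) <= 1)%N &&
  (\sum_(i < a) (lshift b i \in B) + \sum_(j < b) (rshift a j \in B) == b)%N.
Proof.
have memE (P : (a + b).-tuple bool) : B = [set i | tnth P i]%SET ->
    (\sum_(i < a) (lshift b i \in B) = height P a)%N /\
    (\sum_(i < a) (lshift b i \in B) + \sum_(j < b) (rshift a j \in B)
       = height P (a + b))%N.
  move=> ->; rewrite !height_sum big_split_ord /=; split; last congr (_ + _)%N;
    by apply: eq_bigr => i _; rewrite inE (tnth_nth false).
have sU := lattice_path_size (snake_upper_path a0 b0).
have sL := lattice_path_size (snake_lower_path a b).
apply/mem_lpm_bases/andP => [[P [/memE[-> ->] pP + _]]|[hB1 /eqP hB2]].
  have sP := size_tuple P.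
  move/(never_aboveP sP sU)/(_ a); rewrite height_snake_upper // a0 subnn min0n.
  by rewrite addn0 => ->; split=> //; rewrite height_size ?sP //; case/andP: pP.
pose P := [tuple i \in B | i < a + b]; have sP := size_tuple P.
have eB : B = [set i | tnth P i]%SET by apply/setP => i; rewrite inE tnth_mktuple.
have [eP1 eP2] := memE _ eB; clearbody P.
rewrite eP1 in hB1; rewrite eP2 in hB2.
have cP : count id P = b by rewrite -(height_size (leqnn _)) sP hB2.
exists P; split=> //.
- apply/andP; rewrite cP eqxx; split=> //.
  by have := count_predC id P; rewrite cP sP => /eqP; rewrite addnC eqn_add2r.
- apply/(never_aboveP sP sU) => k; rewrite height_snake_upper //.
  have [le_ka | lt_ak] := leqP k a.
    have := height_addr P k (a - k); rewrite subnKC // => /andP[h1 h2].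
    by case: k le_ka h1 h2 => [|k]; rewrite ?height0; lia.
  have := height_addr P a (k - a); rewrite subnKC ?(ltnW lt_ak) // => /andP[_ h].
  have [le_kn | lt_nk] := leqP k (a + b).
    have := height_addr P k (a + b - k); rewrite subnKC // hB2; lia.
  by rewrite height_size ?cP ?sP ?(ltnW lt_nk) //; lia.
- apply/(never_aboveP sL sP) => k; rewrite height_snake_lower.
  have [le_kn | lt_nk] := leqP k (a + b); last first.
    by rewrite height_size ?cP ?sP ?(ltnW lt_nk) //; lia.
  by have := height_addr P k (a + b - k); rewrite subnKC // hB2; lia.
Qed.

(* [None] is the basis formed by the whole column, [Some (i, j)] exchanges its
   element j for the element i of the row. *)
Definition snake_basis (a b : nat) (k : option ('I_a * 'I_b)) : {set 'I_(a + b)} :=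
  [set z | match split z, k with
           | inl _, None => false
           | inl i, Some (i', _) => i == i'
           | inr _, None => true
           | inr j, Some (_, j') => j != j'
           end]%SET.

Lemma lshift_snake_basis a b k (i : 'I_a) :
  (lshift b i \in snake_basis a b k) = if k is Some (i', _) then i == i' else false.
Proof. by rewrite inE -[lshift b i]/(unsplit (inl i)) unsplitK; case: k. Qed.

Lemma rshift_snake_basis a b k (j : 'I_b) :
  (rshift a j \in snake_basis a b k) = if k is Some (_, j') then j != j' else true.
Proof. by rewrite inE -[rshift a j]/(unsplit (inr j)) unsplitK; case: k => [[]|]. Qed.

Lemma snake_basis_bases a b (a0 : (0 < a)%N) (b0 : (0 < b)%N) k :
  snake_basis a b k \in bases (snake a0 b0).
Proof.
rewrite mem_snake_bases.
under eq_bigr do rewrite lshift_snake_basis.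
under [X in (_ + X)%N]eq_bigr do rewrite rshift_snake_basis.
case: k => [[i j]|]; last by rewrite sum1_card big1 // card_ord add0n eqxx.
rewrite (bigD1 i) //= eqxx big1 => [|i' /negbTE -> //].
rewrite (bigD1 j) //= eqxx add0n.
rewrite (eq_bigr (fun=> 1%N)) => [|j' -> //]; rewrite sum1_card.
by have := cardC1 j; rewrite card_ord => ->; lia.
Qed.

(** * Inequalities for the dilated polytope *)

(** Adding up the weights on each fibre of [f] allows convex combinations to be indexed by the
    parameters of [snake_basis]. *)
Lemma sum_mem_convex_hull (R : realType) (n : nat) (I K : finType) (D : {set I})
    (v : I -> 'rV[R]_n) (c : K -> R) (f : K -> I) :
  (forall k, f k \in D) -> (forall k, 0 <= c k) -> \sum_k c k = 1 ->
  convex_hull D v (\sum_k c k *: v (f k)).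
Proof.
move=> fD c0 c1; exists (fun i => \sum_(k | f k == i) c k).
  split=> [i _|]; first exact: sumr_ge0.
  by rewrite -c1 [RHS](partition_big f (mem D)) /=.
rewrite (partition_big f (mem D)) //=; apply: eq_bigr => i _.
by rewrite scaler_suml; apply: eq_bigr => k /eqP ->.
Qed.

Lemma sum_delta_mxE (R : nzRingType) (n : nat) (B : {set 'I_n}) (z : 'I_n) :
  (\sum_(i in B) delta_mx ord0 i : 'rV[R]_n) ord0 z = (z \in B)%:R.
Proof.
rewrite summxE; under eq_bigr do rewrite mxE eqxx /=.
have [zB | zNB] := boolP (z \in B).
  rewrite (bigD1 z) //= eqxx big1 ?addr0 // => i /andP[_].
  by rewrite eq_sym => /negbTE ->.
by rewrite big1 // => i iB; case: eqP => // e; rewrite e iB in zNB.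
Qed.

(** The conditions hold at t times each vertex, hence for averages. Conversely, the row coordinates
    and the column deficits have equal sums, so a transport plan between them supplies the weights
    of the exchanges. *)
Lemma mem_snake_polytope (R : realType) a b (a0 : (0 < a)%N) (b0 : (0 < b)%N)
    (t : nat) (x : 'rV[R]_(a + b)) :
  [set t%:R *: y | y in basis_polytope R (snake a0 b0)]%classic x <->
  [/\ forall i, 0 <= x ord0 (lshift b i), forall j, x ord0 (rshift a j) <= t%:R,
      \sum_i x ord0 (lshift b i) = \sum_j (t%:R - x ord0 (rshift a j))
    & \sum_i x ord0 (lshift b i) <= t%:R].
Proof.
have t0 : 0 <= t%:R :> R by [].
split=> [[_ [w [w0 w1] ->] <-]|[x0 xt sumE sumt]].
  have xE z : (t%:R *: \sum_(B in bases (snake a0 b0)) w B *: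
        (\sum_(i in B) delta_mx ord0 i : 'rV_(a + b))) ord0 z =
      t%:R * \sum_(B in bases (snake a0 b0)) w B * (z \in B)%:R :> R.
    rewrite mxE summxE; congr (_ * _); apply: eq_bigr => B _.
    by rewrite mxE sum_delta_mxE.
  have sumlE : \sum_(i < a) t%:R * \sum_(B in bases (snake a0 b0))
        w B * (lshift b i \in B)%:R =
      t%:R * \sum_(B in bases (snake a0 b0))
        w B * (\sum_(i < a) (lshift b i \in B))%N%:R :> R.
    rewrite -mulr_sumr exchange_big; congr (_ * _); apply: eq_bigr => B _.
    by rewrite natr_sum mulr_sumr.
  split.
  - move=> i; rewrite xE mulr_ge0 // sumr_ge0 // => B /w0 wB.
    by rewrite mulr_ge0.
  - move=> j; rewrite xE ler_piMr // -[leRHS]w1 ler_sum // => B /w0 wB.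
    by rewrite ler_piMr // lern1 leq_b1.
  - under eq_bigr do rewrite xE.
    under [RHS]eq_bigr do rewrite xE.
    rewrite sumlE sumrB sumr_const card_ord -[t%:R *+ b]mulr_natr -mulr_sumr -mulrBr.
    congr (_ * _); have -> : b%:R = \sum_(B in bases (snake a0 b0)) w B * b%:R.
      by rewrite -mulr_suml w1 mul1r.
    rewrite exchange_big -sumrB; apply: eq_bigr => B.
    (* A basis has b elements, so it contains as many row elements as it misses column elements. *)
    rewrite mem_snake_bases => /andP[_ /eqP/(congr1 (fun k => k%:R : R)) <-].
    by rewrite -mulr_sumr -mulrBr natrD -[in RHS]natr_sum addrK.
  - under eq_bigr do rewrite xE.
    rewrite sumlE ler_piMr // -[leRHS]w1 ler_sum // => B DB.
    by rewrite ler_piMr ?w0 // lern1; move: DB; rewrite mem_snake_bases => /andP[].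
set u := \sum_(i < a) _ in sumE sumt.
have u0 : 0 <= u by apply: sumr_ge0 => i _; exact: x0.
pose y j := t%:R - x ord0 (rshift a j).
have y0 j : 0 <= y j by rewrite subr_ge0.
have xu i : u = 0 -> x ord0 (lshift b i) = 0.
  by move=> /eqP; rewrite psumr_eq0 // => /allP/(_ i (mem_index_enum _))/eqP.
have yu j : u = 0 -> y j = 0.
  move=> /eqP; rewrite sumE psumr_eq0 => [|j' _]; last exact: y0.
  by move=> /allP/(_ j (mem_index_enum _))/eqP.
have tu : t%:R = 0 :> R -> u = 0 by move=> e; apply/le_anti; rewrite u0 -e sumt.
(* Product coupling of the row coordinates and the deficits [y], both of total [u]; the whole column
   gets the remaining weight. As division by 0 gives 0, that weight is 1 when u = 0 or t = 0. *)
pose c (k : option ('I_a * 'I_b)) : R :=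
  if k is Some (i, j) then x ord0 (lshift b i) * y j / (u * t%:R)
  else 1 - u / t%:R.
have cl i : \sum_j c (Some (i, j)) = x ord0 (lshift b i) / t%:R.
  rewrite /= -mulr_suml -mulr_sumr -sumE.
  have [e|un0] := eqVneq u 0; first by rewrite (xu i e) !mul0r.
  by rewrite invfM mulrA mulfK.
have cr j : \sum_i c (Some (i, j)) = y j / t%:R.
  rewrite /= -mulr_suml -mulr_suml.
  have [e|un0] := eqVneq u 0; first by rewrite (yu j e) mulr0 !mul0r.
  by rewrite invfM mulrA (mulrC u) mulfK.
have sumo (F : option ('I_a * 'I_b) -> R) :
    \sum_k F k = F None + \sum_i \sum_j F (Some (i, j)).
  rewrite (bigD1 None) //=; congr (_ + _); rewrite pair_big /=.
  rewrite (reindex_omap Some id) /=; last by case.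
  by apply: eq_big => [k|[i j]]; rewrite ?eqxx.
have c1 : \sum_k c k = 1.
  by rewrite sumo; under eq_bigr do rewrite cl; rewrite -mulr_suml /= subrK.
exists (\sum_k c k *: (\sum_(i in snake_basis a b k) delta_mx ord0 i : 'rV_(a + b))).
  apply: (sum_mem_convex_hull R _ _ _ _
    (fun B : {set 'I_(a + b)} => \sum_(i in B) delta_mx ord0 i : 'rV[R]_(a + b)) c
    (snake_basis a b)) => //.
    exact: snake_basis_bases.
  move=> [[i j]|] /=; first by rewrite divr_ge0 ?mulr_ge0.
  have [->|tn0] := eqVneq (t%:R : R) 0; first by rewrite invr0 mulr0 subr0.
  by rewrite subr_ge0 ler_pdivrMr ?mul1r // lt_neqAle eq_sym tn0.
apply/rowP => z; rewrite mxE summxE.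
under eq_bigr do rewrite mxE sum_delta_mxE.
rewrite -(splitK z); case: (split z) => [i|j] /=.
  under eq_bigr do rewrite lshift_snake_basis.
  rewrite sumo mulr0 add0r (bigD1 i) //= [X in _ + X]big1 => [|i' ne].
    rewrite addr0; under eq_bigr do rewrite eqxx mulr1.
    rewrite cl; have [e|tn0] := eqVneq (t%:R : R) 0.
      by rewrite (xu i (tu e)) mul0r mulr0.
    by rewrite mulrC divfK.
  by rewrite big1 // => j _; rewrite eq_sym (negbTE ne) mulr0.
under eq_bigr do rewrite rshift_snake_basis.
(* The bases without the column element j are the [Some (i, j)]. *)
transitivity (t%:R * (1 - \sum_i c (Some (i, j)))).
  congr (_ * _); rewrite -[in RHS]c1 !sumo mulr1 -[RHS]addrA; congr (_ + _).
  rewrite -sumrB; apply: eq_bigr => i _.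
  rewrite (bigD1 j) //= [X in _ = X - _](bigD1 j) //= eqxx mulr0 add0r.
  rewrite addrAC subrr add0r; apply: eq_bigr => j' ne.
  by rewrite eq_sym ne mulr1.
rewrite cr; have [e|tn0] := eqVneq (t%:R : R) 0.
  have := yu j (tu e); rewrite /y e mul0r sub0r => /eqP.
  by rewrite oppr_eq0 => /eqP ->.
by rewrite mulrBr mulr1 mulrC divfK // /y opprB addrC subrK.
Qed.

(** * Counting the integer points *)

(** Entries of a tuple with sum s are at most s, so these are the weak compositions of s, with
    entries merely typed by the larger bound t. *)
Lemma card_tuple_sum (m t s : nat) : (s <= t)%N ->
  #|[set u : m.+1.-tuple 'I_t.+1 | \sum_(i <- u) i == s]%N| = 'C(s + m, m).
Proof.
move=> le_st; rewrite addnC -card_ord_partitions.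
have lt_st : (s.+1 <= t.+1)%N by [].
pose f (u : m.+1.-tuple 'I_s.+1) := [tuple of [seq widen_ord lt_st i | i <- u]].
have f_inj : injective f.
  move=> u v /(congr1 val) /= e; apply/val_inj/(inj_map _ e).
  by move=> i j /(congr1 val) /= ij; apply/val_inj.
rewrite -(card_imset _ f_inj); apply: eq_card => u.
apply/idP/imsetP => [|[v + ->]]; last by rewrite !inE /= big_map.
rewrite inE => /eqP sum_u; exists [tuple of [seq inord i | i : 'I_t.+1 <- u]].
  rewrite inE /= big_map; apply/eqP; rewrite -[RHS]sum_u; apply: eq_big_seq => i iu.
  by rewrite inordK // ltnS -sum_u (big_rem i iu) /= leq_addr.
apply/val_inj; rewrite /= -map_comp -[LHS]map_id; apply/eq_in_map => i iu.
by apply/val_inj; rewrite /= inordK // ltnS -sum_u (big_rem i iu) /= leq_addr.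
Qed.

Definition balanced_pairs (a b t : nat) : {set a.-tuple 'I_t.+1 * b.-tuple 'I_t.+1} :=
  [set p : a.-tuple 'I_t.+1 * b.-tuple 'I_t.+1 |
     (\sum_(i <- p.1) i == \sum_(j <- p.2) j)%N && (\sum_(i <- p.1) i <= t)%N]%SET.

Lemma card_balanced_pairs (a b t : nat) : (0 < a)%N -> (0 < b)%N ->
  #|balanced_pairs a b t| =
  (\sum_(s < t.+1) 'C(s + a.-1, a.-1) * 'C(s + b.-1, b.-1))%N.
Proof.
case: a b => [//|a] [//|b] _ _ /=; rewrite -sum1_card.
rewrite (partition_big (fun p : a.+1.-tuple 'I_t.+1 * b.+1.-tuple 'I_t.+1 =>
  inord (\sum_(i <- p.1) i) : 'I_t.+1) predT) //=.
apply: eq_bigr => s _; rewrite sum1_card.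
rewrite -!(card_tuple_sum _ _ _ (leq_ord s)) -cardsX; apply: eq_card => p.
rewrite -topredE /= !inE; case: leqP => [le_t | lt_t]; rewrite ?andbF ?andbT /=.
  (* For sums up to t, [inord] is faithful; larger sums lie neither in [balanced_pairs] nor in the
     fibre over s. *)
  rewrite -(inj_eq val_inj) /= inordK //.
  by apply/andP/andP => -[/eqP-> /eqP->]; rewrite eqxx.
by case: eqP => // e; have := ltn_ord s; rewrite -e ltnNge lt_t.
Qed.

(* The second block is reflected by y -> t - y, in accordance with
   [mem_snake_polytope]. *)
Definition pair_point (R : realType) (a b t : nat)
    (p : a.-tuple 'I_t.+1 * b.-tuple 'I_t.+1) : 'rV[R]_(a + b) :=
  row_mx (\row_i (tnth p.1 i)%:R) (\row_j (t%:R - (tnth p.2 j)%:R)).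

Lemma pair_point_inj (R : realType) (a b t : nat) : injective (pair_point R a b t).
Proof.
move=> [u v] [u' v'] /eq_row_mx[/rowP eu /rowP ev].
congr (_, _); apply: eq_from_tnth => i; apply/val_inj/eqP.
  by have /eqP := eu i; rewrite !mxE eqr_nat.
have /eqP := ev i; rewrite !mxE (inj_eq (addrI _)).
by rewrite eqr_opp eqr_nat.
Qed.

Lemma snake_integer_points (R : realType) a b (a0 : (0 < a)%N) (b0 : (0 < b)%N)
    (t : nat) :
  ([set t%:R *: y | y in basis_polytope R (snake a0 b0)] `&`
     integer_points R (a + b) =
   pair_point R a b t @` [set` balanced_pairs a b t])%classic.
Proof.
apply/seteqP; split=> [x [/mem_snake_polytope[x0 xt sumE sumt] xint]|].
  (* Natural numbers with sum at most t are each at most t, hence fit into ['I_t.+1]. *)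
  have sum_nat n (f : 'I_n -> R) (F : forall i, f i \is a Num.nat) :
      \sum_i f i <= t%:R ->
      exists2 u : n.-tuple 'I_t.+1, forall i, f i = (tnth u i)%:R
        & \sum_i f i = (\sum_(i <- u) i)%N%:R.
    move=> le_t; pose u := [tuple inord (Num.truncn (f i)) : 'I_t.+1 | i < n].
    have uE i : f i = (tnth u i)%:R.
      rewrite tnth_mktuple inordK ?truncnK // ltnS -(ler_nat R) truncnK //.
      apply: le_trans le_t; rewrite (bigD1 i) //= lerDl sumr_ge0 // => j _.
      exact: natr_ge0.
    exists u => //; rewrite big_tuple natr_sum; exact: eq_bigr.
  have [||u uE su] := sum_nat _ (fun i => x ord0 (lshift b i)) => //.
    by move=> i; rewrite natrEint xint x0.
  have [||v vE sv] := sum_nat _ (fun j => t%:R - x ord0 (rshift a j)).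
  - by move=> j; rewrite natrEint subr_ge0 xt rpredB // rpred_nat.
  - by rewrite -sumE.
  exists (u, v); last first.
    apply/rowP => z; rewrite -(splitK z); case: (split z) => i /=.
      by rewrite row_mxEl mxE -uE.
    by rewrite row_mxEr mxE -vE opprB addrC subrK.
  by rewrite /= inE /= -(eqr_nat R) -su -sv sumE eqxx -(ler_nat R) -su sumt.
move=> _ [[u v] + <-]; rewrite /= inE => /andP[/eqP /= sumE sumt].
have El i : pair_point R a b t (u, v) ord0 (lshift b i) = (tnth u i)%:R.
  by rewrite row_mxEl mxE.
have Er j : pair_point R a b t (u, v) ord0 (rshift a j) = t%:R - (tnth v j)%:R.
  by rewrite row_mxEr mxE.
have sumEl : \sum_i pair_point R a b t (u, v) ord0 (lshift b i) =
    (\sum_(i <- u) i)%N%:R.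
  by rewrite big_tuple natr_sum; apply: eq_bigr => i _; rewrite El.
split; last first.
  move=> z; rewrite -(splitK z); case: (split z) => i /=.
    by rewrite El rpred_nat.
  by rewrite Er rpredB // rpred_nat.
apply/mem_snake_polytope; split.
- by move=> i; rewrite El.
- by move=> j; rewrite Er gerBl.
- rewrite sumEl sumE big_tuple natr_sum; apply: eq_bigr => j _.
  by rewrite Er opprB addrC subrK.
- by rewrite sumEl ler_nat.
Qed.

Lemma card_set_finset (T : finType) (D : {set T}) :
  ([set` D] #= `I_#|D|)%card.
Proof.
have -> : [set` D]%classic = (@enum_val _ (mem D) @` [set: 'I_#|D|])%classic.
  apply/seteqP; split=> [x /= xD | _ [i _ <-] /=]; last exact: enum_valP.
  by exists (enum_rank_in xD x); rewrite ?enum_rankK_in.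
apply: card_eq_trans (card_esym card_II).
by apply: inj_card_eq => i j _ _; apply: enum_val_inj.
Qed.

Theorem theorem3p8 (R : realType) (a b : nat) (ha : (2 <= a)%N) (hb : (2 <= b)%N) :
  is_ehrhart_polynomial (basis_polytope R (snake (ltnW ha) (ltnW hb)))
    (1 + ((a.-1)`!%:R * (b.-1)`!%:R)^-1 *:
       \sum_(1 <= i < a + b)
         (\sum_(i.-1 <= j < a + b - 1)
            (-1) ^+ (j.+1 - i)
            * (bernoulli (j.+1 - i) * elem_sym (snake_seq a b) (a + b - 2 - j)
               / j.+1%:R)
            * 'C(j.+1, i)%:R) *: 'X^i).
Proof.
move=> t; exists #|balanced_pairs a b t|; last first.
  by rewrite snake_sum_bin ?card_balanced_pairs // ltnW.
rewrite snake_integer_points.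
apply: card_eq_trans (card_set_finset _ _).
by apply: inj_card_eq => p q _ _; apply: pair_point_inj.
Qed.
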